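(* Let $s,n\in\mathbb N$ with $s\le n$ and let $p,q,R,\eta>0$ satisfy $$q\le\tfrac1{16},\qquad p\le\frac{q}{2^{10}s^2},\qquad R\ge2^{-6}pn,\qquad \eta=2^{-2s-2}.$$ For every $s$-uniform hypergraph $\mathcal H$ with $n$ vertices there is a family $\mathcal X\subset 2^{V(\mathcal H)}$ with $|\mathcal X|\le4(2/q)^{8qn}$ such that: (i) if $L\subset V(\mathcal H)$ and $\mathcal H[L]$ is not $(p/q,\eta R)$-Janson, then $L\subset X$ for some $X\in\mathcal X$; (ii) for each $X\in\mathcal X$, $\mathcal H[X]$ is not $(p,R)$-Janson.
   Context: A hypergraph is identified with its edge set; $\mathcal H[L]=\{E\in\mathcal H:E\subset L\}$ with vertex set $L$. For $\nu:\mathcal G\to\mathbb R_{\ge0}$: $e(\nu)=\sum_{E\in\mathcal G}\nu(E)$, $d_\nu(L)=\sum_{E\in\mathcal G,L\subset E}\nu(E)$, $\Lambda_p(\nu)=\sum_{L\subset V(\mathcal G),|L|\ge2}d_\nu(L)^2p^{-|L|}$. For $p,R>0$, $\mathcal G$ is $(p,R)$-Janson if there exists $\nu:\mathcal G\to\mathbb R_{\ge0}$ with $\Lambda_p(\nu)<e(\nu)^2/R$. *)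

(* Defs.v *)
From HB Require Import structures.
From mathcomp Require Import all_boot all_order all_algebra.
From mathcomp Require Import reals exp.
Set Implicit Arguments. Unset Strict Implicit. Unset Printing Implicit Defensive.
Import Order.TTheory GRing.Theory Num.Theory.
Local Open Scope ring_scope.

(* A hypergraph on the finite ground type T is identified with its edge set
   G : {set {set T}}; its vertex set is given separately as V : {set T}. *)

Definition induced (T : finType) (H : {set {set T}}) (L : {set T}) : {set {set T}} :=
  [set E in H | E \subset L].

Definition uniform (T : finType) (s : nat) (H : {set {set T}}) : Prop :=
  forall E, E \in H -> #|E| = s.

Section Janson.
Variables (R : realType) (T : finType).

Definition e_nu (G : {set {set T}}) (nu : {set T} -> R) : R :=
  \sum_(E in G) nu E.

Definition d_nu (G : {set {set T}}) (nu : {set T} -> R) (L : {set T}) : R :=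
  \sum_(E in G | L \subset E) nu E.

Definition Lambda (V : {set T}) (G : {set {set T}}) (nu : {set T} -> R) (p : R) : R :=
  \sum_(L : {set T} | (L \subset V) && (2 <= #|L|)%N) (d_nu G nu L) ^+ 2 * p ^- #|L|.

Definition janson (V : {set T}) (G : {set {set T}}) (p Rr : R) : Prop :=
  exists nu : {set T} -> R,
    (forall E, E \in G -> 0 <= nu E) /\
    Lambda V G nu p < (e_nu G nu) ^+ 2 / Rr.
End Janson.

(* Main.v *)
Require Import Defs.
From HB Require Import structures.
From mathcomp Require Import boolp classical_sets topology normedtype derive.
From mathcomp Require Import all_boot all_order all_algebra.
From mathcomp Require Import reals exp.
From mathcomp Require Import ring lra.
Import Order.TTheory GRing.Theory Num.Theory.
Import numFieldNormedType.Exports.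
Local Open Scope ring_scope.
Set Implicit Arguments. Unset Strict Implicit. Unset Printing Implicit Defensive.

(** Call a set bad if its induced hypergraph is not [(p/q, eta R)]-Janson; bad sets are
    closed under taking subsets. A bad set [L] is explored by queries "is [J] a subset
    of [L]?". The state is [(S, B)], where [S] is the union of the sets [J] answered
    yes and [B] is the down-closed family of bad sets containing no [J] answered no.
    A query is made only if a yes answer makes progress in one of two ways:
    - it divides [Pr(S u Q in B)], for a [q]-random set [Q], by more than [2^|J|]; as this
      probability stays above [(1 - q)^n], at most [3qn] vertices enter [S] this way;
    - [J] is a single vertex and the yes answer raises by [gamma] the maximum of
      [2 e(rho) - Lambda(rho)] over measures [rho] on the sets [E] with [S u E] not in
      [B], where [Lambda] is weighted to penalise also the degrees of single vertices
      outside [S]; the maximum is at most [p n / alpha], so at most [5qn] vertices enter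
      this way.
    The answers are recovered from the final [S], so there are at most as many outcomes
    as sets of size at most [8qn]. The container is [X = S u {v : S u {v} in B}].
    Suppose that [nu] witnesses that [H[X]] is [(p, R)]-Janson. As no query halves the
    probability, the second moment of [nu(E) / q^|E - S|] on a random [S u Q], conditioned
    on lying in [B], shows that the edges [E] with [S u E] in [B] carry little more
    than half of [nu]. As no vertex raises the potential, the optimality conditions for
    [rho] say that the degrees of [rho] at sets of at least two vertices form a cheap
    fractional cover of all other edges, and by Cauchy-Schwarz these carry
    less than [0.46] of [nu]. *)

(** * Maximising a quadratic function over a box *)

Section BoxMaximum.
Variables (R : realType) (I K : finType) (a M : I -> R) (c : K -> R) (m : K -> I -> R).

Lemma continuous_bigsum (U : topologicalType) (J : Type) (r : seq J) (F : J -> U -> R) :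
  (forall j, continuous (F j)) -> continuous (fun x => \sum_(j <- r) F j x).
Proof.
move=> cF x; elim: r => [|j r IH].
  under eq_fun do rewrite big_nil.
  exact: cvg_cst.
under eq_fun do rewrite big_cons.
by apply: cvgD; [exact: cF|exact: IH].
Qed.

(** In the product topology the box is compact by Tychonoff and [V] is continuous, so the extreme
    value theorem applies. *)
Lemma box_quadratic_max : (forall i, 0 <= M i) ->
  let V f := \sum_i a i * f i - \sum_k c k * (\sum_i m k i * f i) ^+ 2 in
  exists2 f : I -> R, (forall i, 0 <= f i <= M i) &
    forall g : I -> R, (forall i, 0 <= g i <= M i) -> V g <= V f.
Proof.
move=> M0 V.
pose W : topologicalType := prod_topology (fun _ : I => R).
have cproj i : continuous (fun f : W => f i : R) by exact: (@proj_continuous _ (fun=> R) i).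
have clin (w : I -> R) : continuous (fun f : W => \sum_i w i * f i : R).
  apply: (@continuous_bigsum W I _ (fun i (f : W) => w i * f i)) => i f.
  exact: (cvgM (cvg_cst (w i)) (cproj i f)).
have cV : continuous (V : W -> R).
  have cq : continuous (fun f : W => \sum_k c k * (\sum_i m k i * f i) ^+ 2).
    apply: (@continuous_bigsum W K _ (fun k (f : W) => c k * (\sum_i m k i * f i) ^+ 2)) => k f.
    exact: (cvgM (cvg_cst (c k)) (cvgM (clin (m k) f) (clin (m k) f))).
  move=> f; exact: (cvgB (clin a f) (cq f)).
have [] := @compact_EVT_max W R V [set f : W | forall i, `[0, M i] (f i)]%classic.
- by exists (fun=> 0) => i /=; rewrite in_itv /= lexx M0.
- exact: (@tychonoff I (fun=> R) (fun i => `[0, M i]%classic) (fun i => @segment_compact R 0 (M i))).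
- by apply: continuous_subspaceT => f; exact: cV.
move=> f /set_mem fM fmax; exists f => [i|g gM].
  by have := fM i; rewrite /= in_itv.
by apply: fmax; apply: mem_set => i /=; rewrite in_itv /= gM.
Qed.

End BoxMaximum.

(** * Random subsets with independent vertices *)

Section RandomSubset.
Variables (R : realType) (T : finType).
Implicit Types (q : R) (Q J S E K : {set T}) (B : {set {set T}}).

(** The probability that a [q]-random subset of [T] equals [Q]. *)
Definition bern q Q : R := q ^+ #|Q| * (1 - q) ^+ #|~: Q|.

Definition hit q B S : R := \sum_Q bern q Q * (S :|: Q \in B)%:R.

Lemma sum_pow_card (x y : R) :
  \sum_(Q : {set T}) x ^+ #|Q| * y ^+ #|~: Q| = (x + y) ^+ #|T|.
Proof.
rewrite -[RHS]prodr_const bigA_distr; apply: eq_bigr => Q _.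
rewrite (bigID (mem Q)) /=; congr (_ * _).
  by rewrite -[LHS]prodr_const; apply: eq_bigr => i ->.
rewrite -[LHS]prodr_const (eq_bigl (fun i => i \notin Q)); last by move=> i; rewrite inE.
by apply: eq_bigr => i /negPf ->.
Qed.

Lemma sum_bern q : \sum_Q bern q Q = 1.
Proof. by rewrite sum_pow_card addrCA subrr addr0 expr1n. Qed.

(** For [v] in [Q], the sets [Q] and [Q :\ v] have the same union with [v], and their probabilities
    add up to [bern q Q / q]. *)
Lemma sum_bern1 q (f : {set T} -> R) v :
  \sum_Q bern q Q * (f Q * (v \in Q)%:R) = q * \sum_Q bern q Q * f (v |: Q).
Proof.
set A := LHS.
have -> : A = \sum_(Q : {set T} | v \in Q) bern q Q * f Q.
  rewrite [RHS]big_mkcond; apply: eq_bigr => Q _.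
  by case: (v \in Q); rewrite ?mulr1 ?mulr0.
rewrite [in RHS](bigID (fun Q : {set T} => v \in Q)) /=.
rewrite [X in q * (_ + X)](reindex_onto (fun Q : {set T} => Q :\ v) (fun Q : {set T} => v |: Q)) /=; last first.
  by move=> Q vQ; rewrite setU1K.
rewrite mulrDr 2!big_distrr /=.
rewrite [X in _ + X](eq_bigl (fun Q : {set T} => v \in Q)); last first.
  move=> Q; rewrite !inE eqxx /=; apply/eqP/idP => [<-|vQ]; first by rewrite setU11.
  by rewrite setD1K.
rewrite -big_split /=; apply: eq_bigr => Q vQ.
have -> : v |: Q = Q by apply/setUidPr; rewrite sub1set.
rewrite setD1K // /bern (cardsD1 v Q) vQ.
have -> : ~: (Q :\ v) = v |: ~: Q by rewrite setCD setUC.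
have -> : #|v |: ~: Q| = #|~: Q|.+1 by rewrite cardsU1 inE vQ.
rewrite add1n !exprS; ring.
Qed.

(** Conditioning on [J \subset Q] amounts to adding [J] to a fresh random set; the vertices of [J]
    are peeled off one at a time. *)
Lemma sum_bern_sub q (f : {set T} -> R) J :
  \sum_Q bern q Q * (f Q * (J \subset Q)%:R) = q ^+ #|J| * \sum_Q bern q Q * f (J :|: Q).
Proof.
have [m] := ubnP #|J|; elim: m J f => // m IHm J f.
have [->|[v vJ]] := set_0Vmem J.
  rewrite cards0 expr0 mul1r => _; apply: eq_bigr => Q _.
  by rewrite sub0set mulr1 set0U.
rewrite (cardsD1 v J) vJ add1n ltnS => /IHm IH.
transitivity (\sum_Q bern q Q * ((f Q * (v \in Q)%:R) * (J :\ v \subset Q)%:R)).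
  apply: eq_bigr => Q _; rewrite -{1}(setD1K vJ) subUset sub1set -mulrA -natrM.
  by rewrite mulnb.
rewrite IH exprSr -mulrA; congr (_ * _).
under eq_bigr => Q _ do rewrite !inE eqxx /=.
rewrite (sum_bern1 q (fun Q => f ((J :\ v) :|: Q)) v); congr (_ * _).
by apply: eq_bigr => Q _; rewrite setUA [_ :|: [set v]]setUC setD1K.
Qed.

Lemma bern_ge0 q Q : 0 <= q -> q <= 1 -> 0 <= bern q Q.
Proof. by move=> q0 q1; rewrite mulr_ge0 ?exprn_ge0 ?subr_ge0. Qed.

Definition down_closed B := forall Q Q', Q' \in B -> Q \subset Q' -> Q \in B.

Lemma hit_antitone q B S S' : 0 <= q -> q <= 1 -> down_closed B ->
  S \subset S' -> hit q B S' <= hit q B S.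
Proof.
move=> q0 q1 dB sSS'; apply: ler_sum => Q _; apply: ler_wpM2l; first exact: bern_ge0.
case SB: (S' :|: Q \in B) => //=.
by rewrite (dB _ _ SB) // setSU.
Qed.

Lemma hit_mono q B B' S : 0 <= q -> q <= 1 -> B \subset B' -> hit q B S <= hit q B' S.
Proof.
move=> q0 q1 /subsetP sB; apply: ler_sum => Q _; apply: ler_wpM2l; first exact: bern_ge0.
by case SB: (S :|: Q \in B) => //=; rewrite (sB _ SB).
Qed.

Lemma hit_le1 q B S : 0 <= q -> q <= 1 -> hit q B S <= 1.
Proof.
move=> q0 q1; rewrite -(sum_bern q); apply: ler_sum => Q _.
by rewrite ler_piMr ?bern_ge0 // lern1 leq_b1.
Qed.

(** The empty outcome alone contributes this much. *)
Lemma hit_ge q B S : 0 <= q -> q <= 1 -> S \in B -> (1 - q) ^+ #|T| <= hit q B S.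
Proof.
move=> q0 q1 SB; rewrite /hit (bigD1 set0) //= setU0 SB mulr1 {1}/bern cards0 setC0 cardsT.
rewrite expr0 mul1r lerDl; apply: sumr_ge0 => Q _.
by rewrite mulr_ge0 ?bern_ge0.
Qed.

Lemma sum_bern_hit q B S E :
  \sum_Q bern q Q * ((S :|: Q \in B)%:R * (E \subset S :|: Q)%:R) =
  q ^+ #|E :\: S| * hit q B (S :|: E).
Proof.
under eq_bigr => Q _ do rewrite -subDset.
rewrite (sum_bern_sub q (fun Q => (S :|: Q \in B)%:R)); congr (_ * _).
apply: eq_bigr => Q _; congr (_ * (_ \in B)%:R).
by apply/setP => x; rewrite !inE; case: (x \in S); rewrite ?orbT.
Qed.

End RandomSubset.

(** Lagrange's identity: the difference of the two sides is half of a weighted double sum of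
    squares. *)
Lemma cauchy_schwarz (R : realType) (I : finType) (P : pred I) (c x y : I -> R) :
  (forall i, P i -> 0 <= c i) ->
  (\sum_(i | P i) c i * (x i * y i)) ^+ 2 <=
  (\sum_(i | P i) c i * x i ^+ 2) * (\sum_(i | P i) c i * y i ^+ 2).
Proof.
move=> c0.
have H : 0 <= \sum_(i | P i) \sum_(j | P j) c i * c j * (x i * y j - x j * y i) ^+ 2.
  apply: sumr_ge0 => i Pi; apply: sumr_ge0 => j Pj.
  by rewrite mulr_ge0 ?sqr_ge0 // mulr_ge0 ?c0.
set A := (\sum_(i | P i) c i * x i ^+ 2) in H *.
set B := (\sum_(i | P i) c i * y i ^+ 2) in H *.
set C := (\sum_(i | P i) c i * (x i * y i)) in H *.
suff E : \sum_(i | P i) \sum_(j | P j) c i * c j * (x i * y j - x j * y i) ^+ 2 = 2 * (A * B - C ^+ 2).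
  by move: H; rewrite E pmulr_rge0 ?ltr0n // subr_ge0.
have -> : 2 * (A * B - C ^+ 2) = (A * B - C * C) + (B * A - C * C) by ring.
rewrite /A /B /C !big_distrlr /= -!sumrB -big_split /=; apply: eq_bigr => i _.
rewrite -!sumrB -big_split /=; apply: eq_bigr => j _; ring.
Qed.

(** * Second moment bound for the edges [E] with [S u E] in [B] *)

Section SecondMoment.
Variables (R : realType) (T : finType).
Implicit Types (p q : R) (Q J S E K X I : {set T}) (B H : {set {set T}}).

Lemma sum_subset_pow (x : R) I :
  \sum_(K : {set T} | K \subset I) x ^+ #|K| = (1 + x) ^+ #|I|.
Proof.
transitivity (\prod_(i : T) ((if i \in I then x else 0) + 1)).
  rewrite bigA_distr [LHS]big_mkcond; apply: eq_bigr => K _.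
  case: ifPn => [/subsetP KI|/subsetPn[i iK iI]].
    rewrite -prodr_const [LHS]big_mkcond; apply: eq_bigr => i _.
    by case: ifP => // /KI ->.
  by rewrite (bigD1 i) //= iK (negPf iI) mul0r.
rewrite -prodr_const [RHS]big_mkcond; apply: eq_bigr => i _.
by case: ifP => _; rewrite ?add0r // addrC.
Qed.

(** Trades the weights at density [p/q], together with the correlation factor [q ^- #|I|], for
    weights at density [p]. The left sum is at most [(1 + q/p) ^+ #|I| * q ^- #|I| = (1 + p/q) ^+
    #|I| * p ^- #|I|], and the term [K = I] on the right already carries [p ^- #|I|]. *)
Lemma pair_weight_le p q s I : 0 < p -> 0 < q -> (#|I| <= s)%N ->
  \sum_(K : {set T} | (K \subset I) && (2 <= #|K|)%N) (p / q) ^- #|K| * q ^- #|I| <=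
  (1 + p / q) ^+ s * \sum_(K : {set T} | (K \subset I) && (2 <= #|K|)%N) p ^- #|K|.
Proof.
move=> p0 q0 Is.
have pq0 : 0 <= p / q by rewrite divr_ge0 ?ltW.
have [I2|I2] := ltnP #|I| 2.
  rewrite !big_pred0 ?mulr0 //.
    move=> K; apply/negbTE/negP => /andP[/subset_leq_card KI K2].
    by have := leq_trans K2 KI; rewrite leqNgt I2.
  move=> K; apply/negbTE/negP => /andP[/subset_leq_card KI K2].
  by have := leq_trans K2 KI; rewrite leqNgt I2.
apply: (@le_trans _ _ ((1 + p / q) ^+ #|I| * p ^- #|I|)); last first.
  apply: ler_pM.
  - by rewrite exprn_ge0 // addr_ge0.
  - by rewrite invr_ge0 exprn_ge0 // ltW.
  - by rewrite ler_weXn2l // lerDl.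
  rewrite (bigD1 I) ?subxx //= lerDl; apply: sumr_ge0 => K _.
  by rewrite invr_ge0 exprn_ge0 // ltW.
rewrite -big_distrl /=.
apply: (@le_trans _ _ ((1 + q / p) ^+ #|I| * q ^- #|I|)).
  apply: ler_wpM2r; first by rewrite invr_ge0 exprn_ge0 // ltW.
  rewrite -sum_subset_pow.
  rewrite [leRHS](bigID (fun K : {set T} => (2 <= #|K|)%N)) /=.
  rewrite -[leLHS]addr0; apply: lerD.
    by apply: ler_sum => K _; rewrite -exprVn invf_div.
  by apply: sumr_ge0 => K _; rewrite exprn_ge0 // divr_ge0 // ltW.
rewrite -!exprVn -!exprMn; rewrite le_eqVlt; apply/orP; left; apply/eqP; congr (_ ^+ _); field.
by rewrite (gt_eqF p0) (gt_eqF q0).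
Qed.

(** Give [E] the weight [nu E / q ^+ #|E :\: S|] when it lies in [S u Q]. Whenever [S u Q] is in
    [B], failure of the Janson property bounds the squared total weight by [r] times its [Lambda].
    Averaging over [Q] bounds the mass from above by the second moment, and [hitE] bounds the first
    moment from below. *)
Lemma unblocked_mass s p q (r : R) H B S X (nu : {set T} -> R) :
  0 < p -> 0 < q -> q <= 1 -> 0 < r -> uniform s H -> down_closed B ->
  (forall Q, Q \in B -> ~ janson Q (induced H Q) (p / q) r) ->
  (forall E, E \in H -> S :|: E \in B -> hit q B S <= 2 ^+ s * hit q B (S :|: E)) ->
  0 < hit q B S ->
  (forall E, E \in induced H X -> 0 <= nu E) ->
  (\sum_(E in induced H X | S :|: E \in B) nu E) ^+ 2 <=
  4 ^+ s * r * (1 + p / q) ^+ s * Lambda X (induced H X) nu p.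
Proof.
move=> p0 q0 q1 r0 uH dB nj hitE Z0 nu0.
set G := induced H X.
(* Extending [nu] by zero outside [G] lets all sums run over all sets. *)
pose nu' E := if E \in G then nu E else 0.
have nu'0 E : 0 <= nu' E by rewrite /nu'; case: ifP => // /nu0.
have GH E : E \in G -> E \in H by rewrite inE => /andP[].
have nu'H E : E \notin H -> nu' E = 0.
  by rewrite /nu'; case: ifP => // /GH ->.
pose a E := nu' E * q ^- #|E :\: S|.
have a0 E : 0 <= a E by rewrite mulr_ge0 // invr_ge0 exprn_ge0 // ltW.
pose b Q : R := (S :|: Q \in B)%:R.
pose e Q := \sum_E a E * (E \subset S :|: Q)%:R.
pose d Q K := \sum_(E : {set T} | K \subset E) a E * (E \subset S :|: Q)%:R.
pose Z := hit q B S.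
have wb0 Q : 0 <= bern q Q * b Q by rewrite mulr_ge0 // bern_ge0 // ltW.
pose M Q := \sum_(K : {set T} | (2 <= #|K|)%N) (p / q) ^- #|K| * d Q K ^+ 2.
(* The weights [a] are tried as a Janson witness for [S u Q]; the indicator [b Q] disposes of the
   outcomes outside [B]. *)
have step1 Q : b Q * e Q ^+ 2 <= b Q * (r * M Q).
  rewrite /b; case QB: (S :|: Q \in B); last by rewrite !mul0r.
  rewrite !mul1r.
  have eE : e Q = e_nu (induced H (S :|: Q)) a.
    rewrite /e /e_nu [RHS]big_mkcond; apply: eq_bigr => E _.
    rewrite inE; case EH: (E \in H) => /=.
      by case: (E \subset _); rewrite ?mulr1 ?mulr0.
    by rewrite /a nu'H ?EH // !mul0r.
  have dE K : d Q K = d_nu (induced H (S :|: Q)) a K.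
    rewrite /d /d_nu [LHS]big_mkcond [RHS]big_mkcond; apply: eq_bigr => E _.
    rewrite inE; case EH: (E \in H) => /=.
      by case: (E \subset _); case: (K \subset _); rewrite ?mulr1 ?mulr0.
    by rewrite /a nu'H ?EH // !mul0r; case: ifP.
  have : e_nu (induced H (S :|: Q)) a ^+ 2 / r <=
         Lambda (S :|: Q) (induced H (S :|: Q)) a (p / q).
    rewrite leNgt; apply/negP => lt; apply: (nj _ QB); by exists a.
  rewrite -eE ler_pdivrMr // mulrC => /le_trans; apply.
  apply: ler_wpM2l; first exact: ltW.
  rewrite /Lambda /M big_mkcond [leRHS]big_mkcond; apply: ler_sum => K _.
  rewrite -dE mulrC; case: (K \subset _) => //=; case: ifP => // _.
  by rewrite mulr_ge0 ?sqr_ge0 // invr_ge0 exprn_ge0 // divr_ge0 ?ltW.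
have step2 : (\sum_Q bern q Q * b Q * e Q) ^+ 2 <= Z * \sum_Q bern q Q * b Q * e Q ^+ 2.
  have := @cauchy_schwarz R {set T} xpredT (fun Q => bern q Q * b Q) (fun=> 1) e (fun Q _ => wb0 Q).
  under eq_bigr do rewrite mul1r.
  by under [X in X * _]eq_bigr do rewrite expr1n mulr1.
have expE E : \sum_Q bern q Q * b Q * (E \subset S :|: Q)%:R = q ^+ #|E :\: S| * hit q B (S :|: E).
  by rewrite -sum_bern_hit; apply: eq_bigr => Q _; rewrite mulrA.
have qX m : q ^+ m != 0 by rewrite expf_neq0 // gt_eqF.
(* The probability [q ^+ #|E :\: S|] of catching [E] cancels its weight, and [hitE] loses at most
   [2 ^+ s]. *)
have step3 : Z * (\sum_(E in G | S :|: E \in B) nu E) <= 2 ^+ s * \sum_Q bern q Q * b Q * e Q.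
  have -> : \sum_Q bern q Q * b Q * e Q = \sum_E nu' E * hit q B (S :|: E).
    rewrite /e; under eq_bigr do rewrite big_distrr /=.
    rewrite exchange_big /=; apply: eq_bigr => E _.
    under eq_bigr do rewrite mulrCA.
    by rewrite -big_distrr /= expE /a -mulrA mulKf.
  rewrite !big_distrr /= big_mkcond /=; apply: ler_sum => E _.
  have h0 : 0 <= hit q B (S :|: E).
    by apply: sumr_ge0 => Q _; rewrite mulr_ge0 // bern_ge0 // ltW.
  case: ifP => [/andP[EG EB]|_]; last by rewrite mulr_ge0 ?exprn_ge0 // mulr_ge0.
  rewrite /nu' EG mulrC mulrCA; apply: ler_wpM2l; first exact: nu0.
  by apply: hitE => //; exact: GH.
(* Catching both [E] and [F] has the factor [q ^+ #|(E :|: F) :\: S|]; against the two weights this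
   leaves [q ^- #|(E :&: F) :\: S|], which is at most [q ^- #|E :&: F|]. *)
have step4 K : \sum_Q bern q Q * b Q * d Q K ^+ 2 <=
    Z * \sum_(E : {set T} | K \subset E) \sum_(F : {set T} | K \subset F) nu' E * nu' F * q ^- #|E :&: F|.
  rewrite /d; under eq_bigr do rewrite expr2 big_distrlr /= big_distrr /=.
  rewrite exchange_big /= big_distrr /=; apply: ler_sum => E _.
  under eq_bigr do rewrite big_distrr /=.
  rewrite exchange_big /= big_distrr /=; apply: ler_sum => F _.
  rewrite (eq_bigr (fun Q => a E * a F * (bern q Q * b Q * (E :|: F \subset S :|: Q)%:R))); last first.
    by move=> Q _; rewrite subUset -mulnb natrM; ring.
  rewrite -big_distrr /= expE.
  have hZ : hit q B (S :|: (E :|: F)) <= Z by apply: hit_antitone => //; [exact: ltW|exact: subsetUl].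
  rewrite mulrA [leRHS]mulrC; apply: ler_pM => //.
  - by apply: mulr_ge0; [apply: mulr_ge0|rewrite exprn_ge0 // ltW].
  - by apply: sumr_ge0 => Q _; rewrite mulr_ge0 // bern_ge0 // ltW.
  have cE : (#|E :\: S| + #|F :\: S| = #|(E :|: F) :\: S| + #|(E :&: F) :\: S|)%N.
    by rewrite -cardsUI -setDUl -setDIl.
  have -> : a E * a F * q ^+ #|(E :|: F) :\: S| = nu' E * nu' F * q ^- #|(E :&: F) :\: S|.
    rewrite /a mulrACA -!mulrA; congr (_ * (_ * _)).
    rewrite mulrA -invfM -exprD cE exprD; field.
    by rewrite !qX.
  apply: ler_wpM2l; first by rewrite mulr_ge0.
  rewrite lef_pV2 ?posrE ?exprn_gt0 //.
  by apply: ler_wiXn2l => //; [exact: ltW|exact/subset_leq_card/subsetDl].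
have step5 : \sum_Q bern q Q * b Q * M Q <= Z * ((1 + p / q) ^+ s * Lambda X G nu p).
  rewrite /M; under eq_bigr do rewrite big_distrr /=.
  rewrite exchange_big /=.
  pose g (E F : {set T}) := nu' E * nu' F.
  apply: (@le_trans _ _ (\sum_(K : {set T} | (2 <= #|K|)%N) Z * \sum_(E : {set T} | K \subset E)
     \sum_(F : {set T} | K \subset F) g E F * ((p / q) ^- #|K| * q ^- #|E :&: F|))).
    apply: ler_sum => K _; under eq_bigr do rewrite mulrCA.
    rewrite -big_distrr /=.
    have c0 : 0 <= (p / q) ^- #|K| by rewrite invr_ge0 exprn_ge0 // divr_ge0 ?ltW.
    apply: (le_trans (ler_wpM2l c0 (step4 K))).
    rewrite mulrCA big_distrr /= le_eqVlt; apply/orP; left; apply/eqP; congr (_ * _); apply: eq_bigr => E _.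
    by rewrite big_distrr /=; apply: eq_bigr => F _; rewrite mulrCA.
  rewrite -big_distrr /=; apply: ler_wpM2l; first exact: ltW.
  (* Exchanging the sums collects, for each pair of edges, the sets [K] inside their intersection.
     It is used in one direction before [pair_weight_le] and in the other after it. *)
  have flip (c : {set T} -> {set T} -> R) : \sum_(K : {set T} | (2 <= #|K|)%N) \sum_(E : {set T} | K \subset E)
     \sum_(F : {set T} | K \subset F) g E F * c K (E :&: F) =
     \sum_(E : {set T}) \sum_(F : {set T}) g E F * \sum_(K : {set T} | (K \subset E :&: F) && (2 <= #|K|)%N) c K (E :&: F).
    under eq_bigr => K _ do rewrite big_mkcond /=.
    rewrite exchange_big /=; apply: eq_bigr => E _.
    transitivity (\sum_(K : {set T} | (2 <= #|K|)%N) \sum_F 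
       if K \subset E :&: F then g E F * c K (E :&: F) else 0).
      apply: eq_bigr => K _; rewrite (big_mkcond (fun F : {set T} => K \subset F)) /=.
      case: ifP => KE; last by rewrite big1 // => F _; rewrite subsetI KE.
      by apply: eq_bigr => F _; rewrite subsetI KE.
    rewrite exchange_big /=; apply: eq_bigr => F _.
    rewrite big_distrr /= -big_mkcondr; apply: eq_bigl => K; exact: andbC.
  rewrite (flip (fun K I => (p / q) ^- #|K| * q ^- #|I|)).
  have dnu K : d_nu G nu K = \sum_(E : {set T} | K \subset E) nu' E.
    rewrite /d_nu big_mkcondl /=; apply: eq_bigr => E _; rewrite /nu'.
    by [].
  apply: (@le_trans _ _ ((1 + p / q) ^+ s * \sum_(E : {set T}) \sum_(F : {set T})
       g E F * \sum_(K : {set T} | (K \subset E :&: F) && (2 <= #|K|)%N) p ^- #|K|)).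
    rewrite [leRHS]big_distrr /=; apply: ler_sum => E _.
    rewrite [leRHS]big_distrr /=; apply: ler_sum => F _.
    rewrite [leRHS]mulrCA; have [EH|/nu'H EH] := boolP (E \in H); last by rewrite /g EH !mul0r.
    apply: ler_wpM2l; first by rewrite mulr_ge0.
    apply: pair_weight_le => //; rewrite -(uH _ EH).
    exact/subset_leq_card/subsetIl.
  apply: ler_wpM2l; first by rewrite exprn_ge0 // addr_ge0 // divr_ge0 ?ltW.
  rewrite -(flip (fun K _ => p ^- #|K|)) /Lambda.
  rewrite [leRHS]big_mkcond [leLHS]big_mkcond /=; apply: ler_sum => K _.
  case K2: (2 <= #|K|)%N; last by rewrite andbF.
  have -> : \sum_(E : {set T} | K \subset E) \sum_(F : {set T} | K \subset F) g E F * p ^- #|K| = d_nu G nu K ^+ 2 * p ^- #|K|.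
    rewrite dnu expr2 big_distrlr /= big_distrl /=; apply: eq_bigr => E _.
    by rewrite big_distrl.
  rewrite andbT; case: ifP => // KX.
  rewrite dnu big1 ?expr0n ?mul0r // => E KE; rewrite /nu'; case: ifP => //.
  rewrite inE => /andP[_ EX]; by rewrite (subset_trans KE EX) in KX.
have e2 : \sum_Q bern q Q * b Q * e Q ^+ 2 <= r * (Z * ((1 + p / q) ^+ s * Lambda X G nu p)).
  apply: le_trans (ler_wpM2l (ltW r0) step5); rewrite big_distrr /=.
  apply: ler_sum => Q _; have -> : r * (bern q Q * b Q * M Q) = bern q Q * (b Q * (r * M Q)) by ring.
  by rewrite -mulrA; apply: ler_wpM2l (step1 Q); rewrite bern_ge0 // ltW.
have Z2 : 0 < Z ^+ 2 by rewrite exprn_gt0.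
rewrite -(ler_pM2l Z2) -exprMn.
apply: (@le_trans _ _ ((2 ^+ s * \sum_Q bern q Q * b Q * e Q) ^+ 2)).
  rewrite ler_sqr ?nnegrE //.
    by apply: mulr_ge0; [exact: ltW|apply: sumr_ge0 => E /andP[EG _]; exact: nu0].
  apply: mulr_ge0; first by rewrite exprn_ge0.
  apply: sumr_ge0 => Q _; apply: mulr_ge0 => //; apply: sumr_ge0 => E _.
  exact: mulr_ge0.
rewrite exprMn -exprM mulnC exprM (_ : 2 ^+ 2 = 4 :> R); last by ring.
have -> : Z ^+ 2 * (4 ^+ s * r * (1 + p / q) ^+ s * Lambda X G nu p) =
  4 ^+ s * (Z * (r * (Z * ((1 + p / q) ^+ s * Lambda X G nu p)))).
  by ring.
apply: ler_wpM2l; first by rewrite exprn_ge0.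
by apply: le_trans step2 _; apply: ler_wpM2l => //; exact: ltW.
Qed.

End SecondMoment.

(** * The potential: a concave quadratic maximised over measures on blocked sets *)

Section BlockedPotential.
Variables (R : realType) (T : finType) (p alpha : R).
Hypotheses (p_gt0 : 0 < p) (alpha_ge1 : 1 <= alpha).
Implicit Types (Q J S E K X : {set T}) (B G : {set {set T}}) (rho : {set T} -> R).

Let alpha_gt0 : 0 < alpha. Proof. exact: lt_le_trans ltr01 alpha_ge1. Qed.

(** The weights of [Lambda], extended to single vertices with an extra factor [alpha]; this factor
    keeps the potential below [p n / alpha]. *)
Definition cost K : R := if #|K| == 1%N then alpha / p else p ^- #|K|.

Definition deg rho K : R := \sum_(E : {set T} | K \subset E) rho E.

Definition tested S K := (K != set0) && [disjoint K & S].

(** The polarised form of the weighted [Lambda], needed for directional derivatives of [value]. *)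
Definition pairing S rho rho' : R :=
  \sum_(K : {set T} | tested S K) cost K * (deg rho K * deg rho' K).

Definition value S rho : R := 2 * (\sum_E rho E) - pairing S rho rho.

(** The measures live on arbitrary subsets of [T], not only on edges, so the potential depends on
    the state [(S, B)] alone. *)
Definition admissible S B rho :=
  forall E, 0 <= rho E /\ (S :|: E \in B -> rho E = 0).

Definition optimal S B rho :=
  admissible S B rho /\ forall rho', admissible S B rho' -> value S rho' <= value S rho.

Lemma cost_gt0 K : 0 < cost K.
Proof. by rewrite /cost; case: ifP => _; rewrite ?divr_gt0 // invr_gt0 exprn_gt0. Qed.

Lemma deg_ge0 S B rho K : admissible S B rho -> 0 <= deg rho K.
Proof. by move=> ad; apply: sumr_ge0 => E _; have [] := ad E. Qed.

Lemma pairing_ge0 S rho : 0 <= pairing S rho rho.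
Proof.
by apply: sumr_ge0 => K _; rewrite mulr_ge0 ?(ltW (cost_gt0 _)) // -expr2 sqr_ge0.
Qed.

Lemma admissible_nonsub S B rho E : S \in B -> admissible S B rho ->
  E \subset S -> rho E = 0.
Proof. by move=> SB ad ES; have [_] := ad E; apply; rewrite (setUidPl ES). Qed.

(** As [S] is in [B], no set in the support of [rho] lies inside [S], so each is counted at some
    vertex outside [S]. *)
Lemma mass_le_deg1 S B rho : S \in B -> admissible S B rho ->
  \sum_E rho E <= \sum_(v | v \notin S) deg rho [set v].
Proof.
move=> SB ad; rewrite /deg; under [leRHS]eq_bigr do rewrite big_mkcond /=.
rewrite exchange_big /=; apply: ler_sum => E _.
have [ES|/subsetPn[v vE vS]] := boolP (E \subset S).
  rewrite (admissible_nonsub SB ad ES); apply: sumr_ge0 => v _; by case: ifP.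
rewrite (bigD1 v) //= sub1set vE lerDl; apply: sumr_ge0 => u _.
by have [? _] := ad E; case: ifP.
Qed.

Lemma tested1 S v : tested S [set v] = (v \notin S).
Proof.
rewrite /tested -setI_eq0 -card_gt0 cards1 /=.
apply/eqP/idP => [I0|vS].
  by apply/negP => vS; have := in_set0 v; rewrite -I0 !inE eqxx vS.
by apply/setP => x; rewrite !inE; case: eqP => // ->; exact: negbTE.
Qed.

Lemma testedU1 S v K : tested (v |: S) K = tested S K && (v \notin K).
Proof.
by rewrite /tested !disjoints_subset setCU subsetI subsetC sub1set inE andbCA andbC.
Qed.

(** Dropping the quadratic terms of larger sets leaves one independent parabola per vertex. *)
Lemma value_le_deg1 S B rho : S \in B -> admissible S B rho ->
  value S rho <= \sum_(v | v \notin S) (2 * deg rho [set v] - alpha / p * deg rho [set v] ^+ 2).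
Proof.
move=> SB ad; rewrite sumrB -big_distrr /=; apply: lerB.
  by rewrite ler_pM2l ?ltr0n //; exact: mass_le_deg1 ad.
rewrite /pairing (bigID (fun K : {set T} => #|K| == 1%N)) /=.
rewrite -[leLHS]addr0; apply: lerD; last first.
  by apply: sumr_ge0 => K _; rewrite mulr_ge0 ?(ltW (cost_gt0 _)) // -expr2 sqr_ge0.
rewrite big_mkcondl /= (big_cards1 _ (fun K => if tested S K then cost K * (deg rho K * deg rho K) else 0)).
rewrite big_mkcond /=; apply: ler_sum => v _.
by rewrite tested1 /cost cards1 eqxx expr2.
Qed.

Lemma parabola_le (d : R) : 2 * d - alpha / p * d ^+ 2 <= p / alpha.
Proof.
have ap : 0 < alpha / p by rewrite divr_gt0.
have -> : p / alpha = (alpha / p)^-1 by rewrite invf_div.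
move: (alpha / p) ap => k k0.
rewrite -subr_ge0; have -> : k^-1 - (2 * d - k * d ^+ 2) = k^-1 * (1 - k * d) ^+ 2.
  by field; rewrite gt_eqF.
by rewrite mulr_ge0 ?sqr_ge0 // invr_ge0 ltW.
Qed.

Lemma value_le S B rho : S \in B -> admissible S B rho ->
  value S rho <= p / alpha * #|T|%:R.
Proof.
move=> SB ad; apply: le_trans (value_le_deg1 SB ad) _.
have -> : p / alpha * #|T|%:R = \sum_(v : T) p / alpha by rewrite sumr_const mulr_natr.
rewrite big_mkcond; apply: ler_sum => v _; case: ifP => _; first exact: parabola_le.
by rewrite divr_ge0 // ltW.
Qed.

(** A maximiser on a large box is a global one: a measure leaving the box has a vertex degree so
    large that its value is at most [0], the value of the zero measure. *)
Lemma optimal_exists S B : S \in B -> exists rho, optimal S B rho.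
Proof.
move=> SB.
pose M : R := p / alpha * (#|T|%:R + 2).
have pa : 0 < p / alpha by rewrite divr_gt0.
have M0 : 0 <= M by rewrite mulr_ge0 ?addr_ge0 // ltW.
(* A side of length zero forces [rho] to vanish where admissibility demands it. *)
pose bound E := if S :|: E \in B then 0 else M.
have bound0 E : 0 <= bound E by rewrite /bound; case: ifP.
have [rho rhoM] := @box_quadratic_max R {set T} {set T} (fun=> 2) bound
  (fun K => if tested S K then cost K else 0) (fun K E => (K \subset E)%:R) bound0.
have VE f : \sum_E 2 * f E - \sum_K (if tested S K then cost K else 0) *
    (\sum_(E : {set T}) (K \subset E)%:R * f E) ^+ 2 = value S f.
  rewrite /value -big_distrr /=; congr (_ - _).
  rewrite [RHS]big_mkcond; apply: eq_bigr => K _; case: ifP => _; last by rewrite mul0r.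
  rewrite -expr2; congr (_ * _ ^+ 2); rewrite /deg [RHS]big_mkcond; apply: eq_bigr => E _.
  by case: ifP; rewrite ?mul1r ?mul0r.
move=> max; exists rho; split.
  move=> E; have := rhoM E; rewrite /bound => /andP[r0 rM]; split => // EB.
  by apply/eqP; rewrite eq_le r0 andbT; rewrite EB in rM.
move=> rho' ad.
have [/forallP le|] := boolP [forall E, rho' E <= M].
  have := max rho'; rewrite !VE; apply => E; have [-> zE] := ad E.
  by rewrite /bound; case: ifP => [/zE ->|_] //=.
rewrite negb_forall => /existsP[E0]; rewrite -ltNge => ltE0.
have E0S : ~~ (E0 \subset S).
  apply/negP => /(admissible_nonsub SB ad) E00.
  by move: ltE0; rewrite E00 ltNge M0.
have [v vE vS] := subsetPn E0S.
apply: (@le_trans _ _ 0); last first.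
  have := max (fun=> 0); rewrite !VE; have -> : value S (fun=> 0) = 0.
    rewrite /value /pairing !big1 ?mulr0 ?subrr // => K _.
    by rewrite /deg big1 // !mulr0.
  by apply => E; rewrite lexx bound0.
apply: le_trans (value_le_deg1 SB ad) _; rewrite (bigD1 v) //=.
have dM : M < deg rho' [set v].
  apply: lt_le_trans ltE0 _; rewrite /deg (bigD1 E0) /= ?sub1set // lerDl.
  by apply: sumr_ge0 => E _; have [] := ad E.
apply: (@le_trans _ _ (2 * deg rho' [set v] - alpha / p * deg rho' [set v] ^+ 2 + p / alpha * #|T|%:R)).
  rewrite lerD2l.
  have -> : p / alpha * #|T|%:R = \sum_(v : T) p / alpha by rewrite sumr_const mulr_natr.
  rewrite big_mkcond; apply: ler_sum => u _; case: ifP => _; first exact: parabola_le.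
  exact: ltW.
(* With [k = p / alpha] and degree [k * y], the bound becomes [k * (2 * y - y ^+ 2 + n)], which is
   at most zero once [y > n + 2]; this dictates [M]. *)
move: dM; rewrite /M (_ : alpha / p = (p / alpha)^-1); last by rewrite invf_div.
move: (p / alpha) pa (deg _ _) => k k0 d; rewrite mulrC -ltr_pdivlMr // => dM.
have -> : d = k * (d / k) by rewrite mulrC divfK // gt_eqF.
have n0 : 0 <= #|T|%:R :> R by [].
move: (d / k) (#|T|%:R) n0 dM => y n n0 ny.
have -> : 2 * (k * y) - k^-1 * (k * y) ^+ 2 + k * n = k * (2 * y - y ^+ 2 + n).
  by field; rewrite gt_eqF.
by rewrite pmulr_rle0 //; nra.
Qed.

Lemma degD rho delta t K :
  deg (fun E => rho E + t * delta E) K = deg rho K + t * deg delta K.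
Proof. by rewrite /deg big_split /= big_distrr. Qed.

Lemma valueD S rho delta t :
  value S (fun E => rho E + t * delta E) =
  value S rho + 2 * t * (\sum_E delta E - pairing S rho delta) - t ^+ 2 * pairing S delta delta.
Proof.
rewrite /value big_split -big_distrr /=.
have -> : pairing S (fun E => rho E + t * delta E) (fun E => rho E + t * delta E) =
  pairing S rho rho + (2 * t) * pairing S rho delta + t ^+ 2 * pairing S delta delta.
  rewrite /pairing !big_distrr -!big_split /=; apply: eq_bigr => K _.
  rewrite !degD; ring.
ring.
Qed.

(** First-order condition at a maximum: the derivative of [value] in a feasible direction cannot be
    positive. *)
Lemma optimal_deriv S B rho delta : optimal S B rho ->
  (forall t, 0 <= t <= 1 -> admissible S B (fun E => rho E + t * delta E)) ->
  \sum_E delta E <= pairing S rho delta.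
Proof.
move=> [_ opt] ad; rewrite leNgt; apply/negP; rewrite -subr_gt0.
have P0 := pairing_ge0 S delta.
have vD t : 0 <= t <= 1 -> _ := fun ht => opt _ (ad t ht).
have {vD} : forall t, 0 <= t <= 1 -> 2 * t * (\sum_E delta E - pairing S rho delta) - t ^+ 2 * pairing S delta delta <= 0.
  by move=> t /vD; rewrite valueD -addrA gerDl.
move: (_ - _) (pairing S delta delta) P0 => L P P0 h L0.
(* The parabola [2 * t * L - t ^+ 2 * P] is tested at [t = 1] or at its vertex [t = L / P],
   whichever stays within [[0, 1]]. *)
have [PL|PL] := leP P L.
  have /h : 0 <= (1 : R) <= 1 by rewrite ler01 lexx.
  by nra.
have P1 : 0 < P by exact: lt_trans PL.
have /h : 0 <= L / P <= 1.
  by rewrite divr_ge0 ?ler_pdivrMr ?mul1r ?ltW.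
have -> : 2 * (L / P) * L - (L / P) ^+ 2 * P = L ^+ 2 / P by field; rewrite gt_eqF.
by rewrite leNgt divr_gt0 // exprn_gt0.
Qed.

Definition opt S B : {set T} -> R := xget (fun=> 0) (optimal S B).

Definition potential S B : R := value S (opt S B).

Lemma optP S B : S \in B -> optimal S B (opt S B).
Proof. by move=> SB; exact: (xgetPex (fun=> 0) (optimal_exists SB)). Qed.

Lemma potential_le S B : S \in B -> potential S B <= p / alpha * #|T|%:R.
Proof. by move=> SB; have [ad _] := optP SB; exact: value_le ad. Qed.

Lemma potential_ge0 S B : S \in B -> 0 <= potential S B.
Proof.
move=> SB; have [_ mx] := optP SB.
have -> : 0 = value S (fun=> 0).
  rewrite /value /pairing !big1 ?mulr0 ?subrr // => K _.
  by rewrite /deg big1 // !mulr0.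
by apply: mx => E.
Qed.

Lemma admissible_mono S S' B B' rho : down_closed B -> S \subset S' -> B' \subset B ->
  admissible S B rho -> admissible S' B' rho.
Proof.
move=> dB SS' /subsetP B'B ad E; have [r0 rz] := ad E; split => // /B'B EB.
by apply: rz; apply: dB EB _; exact: setSU.
Qed.

(** The old maximiser remains admissible, and fewer sets [K] are tested, so its penalty can only
    drop. *)
Lemma potential_mono S S' B B' : down_closed B -> S \in B -> S' \in B' ->
  S \subset S' -> B' \subset B -> potential S B <= potential S' B'.
Proof.
move=> dB SB SB' SS' B'B; have [ad _] := optP SB; have [_ mx] := optP SB'.
apply: le_trans (mx _ (admissible_mono dB SS' B'B ad)).
rewrite /potential /value lerD2l lerN2 /pairing.
rewrite big_mkcond [leRHS]big_mkcond; apply: ler_sum => K _.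
have t0 : 0 <= cost K * (deg (opt S B) K * deg (opt S B) K).
  by rewrite mulr_ge0 ?(ltW (cost_gt0 _)) // -expr2 sqr_ge0.
case: ifP => [/andP[K0 dis]|_]; last by case: ifP.
by rewrite /tested K0 (disjointWr SS' dis).
Qed.

(** The first-order condition in the direction of a point mass at [E]. *)
Lemma optimal_cover S B rho E : optimal S B rho -> S :|: E \notin B ->
  1 <= \sum_(K : {set T} | tested S K && (K \subset E)) cost K * deg rho K.
Proof.
move=> op EB; have [ad _] := op.
have := @optimal_deriv S B rho (fun F => (F == E)%:R) op.
rewrite (bigD1 E) //= eqxx big1 ?addr0; last by move=> F /negPf ->.
have -> : pairing S rho (fun F => (F == E)%:R) =
  \sum_(K : {set T} | tested S K && (K \subset E)) cost K * deg rho K.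
  rewrite /pairing [RHS]big_mkcondr; apply: eq_bigr => K _.
  have -> : deg (fun F => (F == E)%:R) K = (K \subset E)%:R.
    rewrite /deg big_mkcond (bigD1 E) //= eqxx big1 ?addr0; first by case: ifP.
    by move=> F /negPf ->; case: ifP.
  by case: (K \subset E); rewrite ?mulr1 ?mulr0.
apply => t /andP[t0 _] F; have [r0 rz] := ad F; split.
  by rewrite addr_ge0 // mulr_ge0.
move=> FB; rewrite rz // add0r; case: eqP => [FE|_]; last by rewrite mulr0.
by rewrite -FE FB in EB.
Qed.

Lemma deg_restrict rho v K :
  deg (fun E => rho E * (v \in E)%:R) K = deg rho (v |: K).
Proof.
rewrite /deg [RHS](eq_bigl (fun E : {set T} => (K \subset E) && (v \in E))); last first.
  by move=> E; rewrite subUset sub1set andbC.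
by rewrite [RHS]big_mkcondr; apply: eq_bigr => E _; case: (v \in E); rewrite ?mulr1 ?mulr0.
Qed.

Lemma sum_restrict rho v : \sum_(E : {set T}) rho E * (v \in E)%:R = deg rho [set v].
Proof.
rewrite /deg [RHS]big_mkcond; apply: eq_bigr => E _.
by rewrite sub1set; case: ifP; rewrite ?mulr1 ?mulr0.
Qed.

(** The part of [rho] on sets containing [v] may be scaled up or down, so the first-order condition
    holds with equality in that direction. *)
Lemma optimal_link S B rho v : optimal S B rho ->
  \sum_(K : {set T} | tested S K) cost K * (deg rho K * deg rho (v |: K)) = deg rho [set v].
Proof.
move=> op; have [ad _] := op; rewrite -sum_restrict.
pose delta c E := c * (rho E * (v \in E)%:R).
have degc c K : deg (delta c) K = c * deg rho (v |: K).
  by rewrite -deg_restrict /deg big_distrr.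
have le c : -1 <= c -> \sum_E delta c E <= pairing S rho (delta c).
  move=> c1; apply: (optimal_deriv op) => t /andP[t0 t1] E.
  have [r0 rz] := ad E; rewrite /delta; split; last by move=> /rz ->; rewrite mul0r !mulr0 addr0.
  case: (v \in E); rewrite ?mulr1 ?mulr0 ?addr0 //.
  have -> : rho E + t * (c * rho E) = rho E * (1 + t * c) by ring.
  by rewrite mulr_ge0 //; nra.
have sc c : pairing S rho (delta c) =
    c * \sum_(K : {set T} | tested S K) cost K * (deg rho K * deg rho (v |: K)).
  by rewrite big_distrr; apply: eq_bigr => K _ /=; rewrite degc; ring.
apply/eqP; rewrite eq_le.
have := le (-1) (lexx _); have := le 1; rewrite !sc -!big_distrr /= !mul1r !mulN1r lerN2.
by move=> -> //; rewrite ?andbT // (le_trans _ ler01) // oppr_le0 ler01.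
Qed.

Lemma optimal_mass S B rho : optimal S B rho -> \sum_E rho E = pairing S rho rho.
Proof.
move=> op; have [ad _] := op.
have le c : -1 <= c -> \sum_E c * rho E <= pairing S rho (fun E => c * rho E).
  move=> c1; apply: (optimal_deriv op) => t /andP[t0 t1] E.
  have [r0 rz] := ad E; split; last by move=> /rz ->; rewrite !mulr0 addr0.
  have -> : rho E + t * (c * rho E) = rho E * (1 + t * c) by ring.
  by rewrite mulr_ge0 //; nra.
have sc c : pairing S rho (fun E => c * rho E) = c * pairing S rho rho.
  rewrite big_distrr; apply: eq_bigr => K _ /=.
  have -> : deg (fun E => c * rho E) K = c * deg rho K by rewrite /deg big_distrr.
  by ring.
apply/eqP; rewrite eq_le.
have := le (-1) (lexx _); have := le 1; rewrite !sc -!big_distrr /= !mul1r !mulN1r lerN2.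
by move=> -> //; rewrite (le_trans _ ler01) // oppr_le0 ler01.
Qed.

(** A new vertex multiplies the cost by [1/p], except that the surcharge [alpha] disappears when [K]
    is a single vertex. *)
Lemma costU1 v K : K != set0 -> v \notin K -> cost K <= alpha * p * cost (v |: K).
Proof.
rewrite -card_gt0 => K0 vK; rewrite /cost cardsU1 vK add1n eqSS.
rewrite [_ == 0%N]eqn0Ngt K0 /= exprS invfM.
have px := exprn_gt0 #|K| p_gt0.
have -> : alpha * p * (p^-1 * p ^- #|K|) = alpha * p ^- #|K|.
  by rewrite mulrA mulfK // gt_eqF.
case: eqP => [->|_]; first by rewrite expr1.
by rewrite ler_peMl // invr_ge0 ltW.
Qed.

(* Once [v] is moved to [S] the sets [K] containing [v] are no longer tested, which
   leaves room to raise [rho] on the sets containing [v] by the factor [1 + 1/(alpha p)]. *)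
Lemma potential_gain S B v : down_closed B -> S \in B -> v |: S \in B -> v \notin S ->
  potential S B + (deg (opt S B) [set v] / p) ^+ 2 <= potential (v |: S) B.
Proof.
move=> dB SB vSB vS; have op := optP SB; have [ad _] := op; have [_ mx] := optP vSB.
rewrite {1}/potential; set rho := opt S B in op ad *.
pose d K := deg rho K.
(* This [x] maximises [2 * x * Lv - x ^+ 2 * (alpha * p * Lv)], the part of the gain that depends on
   [x] once [A2] is bounded by [alpha * p * Lv]. *)
pose x : R := (alpha * p)^-1.
have ap : 0 < alpha * p by rewrite mulr_gt0.
pose A0 := \sum_(K : {set T} | tested S K && (v \notin K)) cost K * (d K * d K).
pose A1 := \sum_(K : {set T} | tested S K && (v \notin K)) cost K * (d K * d (v |: K)).
pose A2 := \sum_(K : {set T} | tested S K && (v \notin K)) cost K * (d (v |: K) * d (v |: K)).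
pose Lv := \sum_(K : {set T} | tested S K && (v \in K)) cost K * (d K * d K).
have cd0 K : 0 <= cost K * (d K * d K).
  by rewrite mulr_ge0 ?(ltW (cost_gt0 _)) // -expr2 sqr_ge0.
have A0E : pairing S rho rho = Lv + A0 by rewrite /pairing (bigID (fun K : {set T} => v \in K)).
have A1E : A1 = d [set v] - Lv.
  have LvE : \sum_(K : {set T} | tested S K && (v \in K)) cost K * (d K * d (v |: K)) = Lv.
    by apply: eq_bigr => K /andP[_ vK]; have /setUidPr -> : [set v] \subset K by rewrite sub1set.
  have := optimal_link v op; rewrite (bigID (fun K : {set T} => v \in K)) /=.
  by rewrite -[X in _ = X]/(d [set v]) => <-; rewrite -LvE [RHS]addrC addKr.
(* Deleting [v] from [K] makes [Lv] comparable with [A2] term by term; the set [[set v]] becomes the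
   empty set, which [A2] omits. *)
have LvE : Lv = \sum_(K : {set T} | [disjoint K & S] && (v \notin K)) cost (v |: K) * (d (v |: K) * d (v |: K)).
  rewrite /Lv (reindex_onto (fun K => v |: K) (fun K => K :\ v)) /=; last first.
    by move=> K /andP[_ vK]; rewrite setD1K.
  apply: eq_bigl => K; rewrite setU11 andbT /tested !disjoints_subset subUset sub1set inE vS /=.
  rewrite -card_gt0 (cardD1 v) setU11 /=; congr andb; apply/eqP/idP => [<-|vK].
    by rewrite !inE eqxx.
  by rewrite setU1K.
have A2le : A2 <= alpha * p * Lv.
  rewrite /A2 LvE big_distrr /= big_mkcond [leRHS]big_mkcond /=; apply: ler_sum => K _.
  have t0 : 0 <= alpha * p * (cost (v |: K) * (d (v |: K) * d (v |: K))).
    by rewrite mulr_ge0 // ltW.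
  case: ifP => [/andP[/andP[K0 ->] vK]|_]; last by case: ifP.
  rewrite vK /= [leRHS]mulrA; apply: ler_wpM2r; first by rewrite -expr2 sqr_ge0.
  exact: costU1.
have Lvge : alpha / p * d [set v] ^+ 2 <= Lv.
  rewrite /Lv (bigD1 [set v]) /=; last by rewrite tested1 vS inE eqxx.
  rewrite {1}/cost cards1 eqxx expr2 lerDl; apply: sumr_ge0 => K _; exact: cd0.
pose rho' E := rho E + x * (rho E * (v \in E)%:R).
have ad' : admissible (v |: S) B rho'.
  apply: (@admissible_mono S _ B B) => //; first exact: subsetUr.
  move=> E; have [r0 rz] := ad E; rewrite /rho'; split; last first.
    by move=> /rz ->; rewrite mul0r mulr0 addr0.
  by rewrite addr_ge0 // mulr_ge0 ?mulr_ge0 // invr_ge0 ltW.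
apply: le_trans (mx _ ad').
have -> : value (v |: S) rho' = 2 * (\sum_E rho E + x * d [set v]) - (A0 + 2 * x * A1 + x ^+ 2 * A2).
  rewrite /value /rho' big_split -big_distrr /= sum_restrict; congr (_ - _).
  rewrite /pairing (eq_bigl _ _ (testedU1 S v)) /A0 /A1 /A2 !big_distrr -!big_split /=.
  by apply: eq_bigr => K _; rewrite degD deg_restrict /d; ring.
rewrite /value A0E A1E; move: A2le Lvge; rewrite -/(d [set v]).
move: (\sum_E rho E) (d [set v]) => e d1 A2le Lvge.
have xA2 : x ^+ 2 * A2 <= x * Lv.
  have -> : x * Lv = x ^+ 2 * (alpha * p * Lv).
    by rewrite expr2 mulrA -[x * x * _]mulrA mulVf ?mulr1 // gt_eqF.
  by apply: ler_wpM2l => //; rewrite sqr_ge0.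
have dx : (d1 / p) ^+ 2 <= x * Lv.
  have -> : (d1 / p) ^+ 2 = x * (alpha / p * d1 ^+ 2).
    by rewrite /x; field; rewrite !gt_eqF.
  by apply: ler_wpM2l => //; rewrite invr_ge0 ltW.
have Lv0 : 0 <= Lv by apply: sumr_ge0 => K _; exact: cd0.
have -> : 2 * (e + x * d1) - (A0 + 2 * x * (d1 - Lv) + x ^+ 2 * A2) =
  2 * e - (Lv + A0) + (Lv + x * Lv + (x * Lv - x ^+ 2 * A2)) by ring.
by rewrite lerD2l; lra.
Qed.

(** By [optimal_cover] the degrees of the optimal measure cover each blocked edge; single vertices
    supply at most [theta], so sets of at least two vertices supply [1 - theta]. Integrating against
    [nu] and applying Cauchy-Schwarz gives a product of the potential and [Lambda]. *)
Lemma blocked_mass S B X G (nu : {set T} -> R) (theta : R) :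
  S \in B -> theta <= 1 ->
  (forall E, E \in G -> E \subset X) -> (forall E, E \in G -> 0 <= nu E) ->
  (forall E, E \in G -> S :|: E \notin B ->
     \sum_(v in E :\: S) alpha / p * deg (opt S B) [set v] <= theta) ->
  ((1 - theta) * \sum_(E in G | S :|: E \notin B) nu E) ^+ 2 <=
  p / alpha * #|T|%:R * Lambda X G nu p.
Proof.
move=> SB th GX nu0 small; have op := optP SB; have [ad _] := op.
set rho := opt S B in op ad small.
pose P K := tested S K && (2 <= #|K|)%N.
have P2 K : P K -> cost K = p ^- #|K|.
  by rewrite /P /cost => /andP[_]; case: eqP => // ->.
have c0 K : 0 <= cost K := ltW (cost_gt0 K).
have d0 K : 0 <= deg rho K by exact: deg_ge0 ad.
have cover E : E \in G -> S :|: E \notin B ->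
    1 - theta <= \sum_(K : {set T} | P K && (K \subset E)) cost K * deg rho K.
  move=> EG EB; have := optimal_cover op EB.
  rewrite (bigID (fun K : {set T} => #|K| == 1%N)) /= => h.
  have le1 : \sum_(K : {set T} | tested S K && (K \subset E) && (#|K| == 1%N)) cost K * deg rho K <= theta.
    apply: le_trans (small E EG EB).
    rewrite big_mkcondl /= (big_cards1 _ (fun K => if tested S K && (K \subset E) then cost K * deg rho K else 0)).
    rewrite [leRHS]big_mkcond /=; apply: ler_sum => v _.
    by rewrite tested1 sub1set inE /cost cards1 eqxx.
  have -> : \sum_(K : {set T} | P K && (K \subset E)) cost K * deg rho K =
     \sum_(K : {set T} | tested S K && (K \subset E) && (#|K| != 1%N)) cost K * deg rho K.
    apply: eq_bigl => K; rewrite /P /tested -card_gt0.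
    by case: #|K| => [|[|m]] /=; rewrite ?andbF ?andbT.
  lra.
have main : (1 - theta) * \sum_(E in G | S :|: E \notin B) nu E <=
    \sum_(K : {set T} | P K) cost K * (deg rho K * d_nu G nu K).
  apply: (@le_trans _ _ (\sum_(E in G | S :|: E \notin B) \sum_(K : {set T} | P K && (K \subset E)) cost K * deg rho K * nu E)).
    rewrite big_distrr /=; apply: ler_sum => E /andP[EG EB].
    rewrite -big_distrl /=; apply: ler_wpM2r; [exact: nu0|exact: cover].
  under eq_bigr => E _ do rewrite big_mkcondr /=.
  rewrite exchange_big /=; apply: ler_sum => K _.
  have k0 : 0 <= cost K * deg rho K by rewrite mulr_ge0.
  rewrite [leRHS]mulrA; move: (cost K * deg rho K) k0 => k k0.
  rewrite /d_nu big_distrr /= big_mkcond [leRHS]big_mkcond /=; apply: ler_sum => E _.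
  case EG: (E \in G) => //=; case: (K \subset E); case: (S :|: E \notin B) => //=.
  by rewrite mulr_ge0 ?nu0.
have lhs0 : 0 <= (1 - theta) * \sum_(E in G | S :|: E \notin B) nu E.
  by rewrite mulr_ge0 ?subr_ge0 // sumr_ge0 // => E /andP[EG _]; exact: nu0.
apply: (@le_trans _ _ ((\sum_(K : {set T} | P K) cost K * (deg rho K * d_nu G nu K)) ^+ 2)).
  by rewrite ler_sqr ?nnegrE // (le_trans lhs0 main).
apply: le_trans (cauchy_schwarz _ _ (fun K _ => c0 K)) _; apply: ler_pM.
- by apply: sumr_ge0 => K _; rewrite mulr_ge0 // sqr_ge0.
- by apply: sumr_ge0 => K _; rewrite mulr_ge0 // sqr_ge0.
- apply: (@le_trans _ _ (pairing S rho rho)).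
    rewrite /pairing big_mkcondr /=; apply: ler_sum => K _.
    by case: ifP => _; [rewrite expr2|rewrite mulr_ge0 // -expr2 sqr_ge0].
  (* At the optimum mass and penalty agree, so the penalty equals the potential. *)
  have : value S rho = pairing S rho rho by rewrite /value (optimal_mass op); ring.
  by move <-; exact: potential_le.
rewrite /Lambda big_mkcond [leRHS]big_mkcond /=; apply: ler_sum => K _.
have t0 : 0 <= d_nu G nu K ^+ 2 / p ^+ #|K| by rewrite divr_ge0 ?sqr_ge0 // exprn_ge0 // ltW.
case PK: (P K); last by case: ifP.
rewrite (P2 K PK) mulrC; move/andP: PK => [_ ->]; rewrite andbT; case: ifP => // KX.
rewrite /d_nu big1 ?expr0n ?mul0r // => E /andP[EG KE].
by rewrite (subset_trans KE (GX _ EG)) in KX.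
Qed.

End BlockedPotential.

(** * An abstract query procedure and its termination *)

Section Algorithm.
Variables (T : finType) (query : {set T} * {set {set T}} -> option {set T}).
Implicit Types (L M S J Q : {set T}) (st : {set T} * {set {set T}}).

Definition answer L st :=
  if query st is Some J then
    if J \subset L then (st.1 :|: J, st.2) else (st.1, [set Q in st.2 | ~~ (J \subset Q)])
  else st.

Lemma answer_sub L st : st.1 \subset (answer L st).1.
Proof. by rewrite /answer; case: (query st) => // J; case: ifP => //=; rewrite subsetUl. Qed.

(* The yes-answers are recorded in the first component, so they determine the run. *)
Lemma iter_answer_eq L M st k :
  (iter k (answer L) st).1 \subset M -> M \subset L ->
  iter k (answer M) st = iter k (answer L) st.
Proof.
move=> + ML; elim: k => //= k IH sM.
rewrite IH; last exact: subset_trans (answer_sub _ _) sM.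
move: sM; rewrite /answer; case: (query _) => // J.
case: ifP => [_ /=|JL _]; first by rewrite subUset => /andP[_ ->].
by case: ifP => // JM; rewrite (subset_trans JM ML) in JL.
Qed.

Definition size_of st := (#|st.2| + #|~: st.1|)%N.

(** Each query lowers [size_of]: a yes answer shrinks the complement of [st.1], and a no answer
    removes at least [st.1 :|: J] from [st.2]. *)
Lemma iter_answer_stops (inv : {set T} * {set {set T}} -> Prop) L st :
  inv st -> (forall st, inv st -> inv (answer L st)) ->
  (forall st J, inv st -> query st = Some J ->
     ~~ (J \subset st.1) && (st.1 :|: J \in st.2)) ->
  query (iter (size_of st) (answer L) st) = None.
Proof.
move=> inv0 invS valid.
suff H k st' : inv st' -> (size_of st' <= k)%N -> query (iter k (answer L) st') = None by exact: H.
elim: k st' => [|k IH] st' i' sz.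
  rewrite /=; case E: (query st') => [J|] //.
  have /andP[_ SJ] := valid _ _ i' E.
  by move: sz; rewrite leqn0 addn_eq0 cards_eq0 => /andP[/eqP B0 _]; rewrite B0 inE in SJ.
rewrite iterSr; case E: (query st') => [J|]; last first.
  have fix_ m : iter m (answer L) st' = st'.
    by elim: m => //= m ->; rewrite /answer E.
  by rewrite -iterSr fix_.
have /andP[JS SJ] := valid _ _ i' E.
apply: IH; first exact: invS.
rewrite -ltnS; apply: leq_trans sz; rewrite /size_of /answer E.
case: ifP => _ /=.
  rewrite ltn_add2l; apply: proper_card; rewrite properE !setCS subsetUl /=.
  by rewrite subUset subxx.
rewrite ltn_add2r; apply: proper_card; apply/properP; split.
  by apply/subsetP => Q; rewrite inE => /andP[].
by exists (st'.1 :|: J) => //; rewrite inE subsetUr andbF.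
Qed.

End Algorithm.

(** * The exploration of a bad set and its invariants *)

Section Containers.
Variables (R : realType) (T : finType) (p q alpha gamma : R) (B0 : {set {set T}}).
Hypotheses (p_gt0 : 0 < p) (alpha_ge1 : 1 <= alpha) (q_ge0 : 0 <= q) (q_le1 : q <= 1).
Hypothesis B0_down : down_closed B0.
Implicit Types (L M S J Q : {set T}) (B : {set {set T}}) (st : {set T} * {set {set T}}).

Definition splits S B J :=
  [&& [disjoint J & S], J != set0, S :|: J \in B &
   (2 ^+ #|J| * hit q B (S :|: J) < hit q B S) ||
   (#|J| == 1%N) && (potential p alpha S B + gamma <= potential p alpha (S :|: J) B)].

Definition pick_query st := [pick J | splits st.1 st.2 J].

Definition run L := iter (size_of (set0, B0)) (answer pick_query L) (set0, B0).

(** Here [a] counts the vertices that entered through a drop of the probability, and [b] those that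
    entered through a rise of the potential. *)
Definition run_inv L st :=
  [/\ down_closed st.2, st.1 \subset L, L \in st.2, st.2 \subset B0 &
   exists a b, [/\ (#|st.1| <= a + b)%N, 2 ^+ a * hit q st.2 st.1 <= 1 &
                   gamma * b%:R <= potential p alpha st.1 st.2]].

(** Under either answer [hit] never rises and the potential never falls, so only the counter of the
    progress made needs updating. *)
Lemma invariant_answer L st : run_inv L st -> run_inv L (answer pick_query L st).
Proof.
case: st => S B inv; have := inv; rewrite {2}/run_inv /= => -[dB SL LB BB0 [a [b [cS hS pS]]]].
rewrite /answer /pick_query; case: pickP => //= J /and4P[dJS J0 SJB typ].
have SB : S \in B by exact: dB LB SL.
case: ifP => JL /=.
  split => //; first by rewrite subUset SL JL.
  have cSJ : (#|S :|: J| <= #|S| + #|J|)%N by rewrite -cardsUI leq_addr.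
  have pmono : potential p alpha S B <= potential p alpha (S :|: J) B.
    by apply: potential_mono => //; exact: subsetUl.
  have hmono : hit q B (S :|: J) <= hit q B S by apply: hit_antitone => //; exact: subsetUl.
  have a0 : 0 <= (2 : R) ^+ a by rewrite exprn_ge0.
  case/orP: typ => [lt|/andP[/eqP J1 gn]].
    exists (a + #|J|)%N, b; split.
    - by rewrite addnAC; apply: leq_trans cSJ _; rewrite leq_add2r.
    - rewrite exprD -mulrA; apply: le_trans hS; apply: ler_wpM2l => //; exact: ltW.
    - exact: le_trans pmono.
  exists a, b.+1; split.
  - by rewrite addnS -addn1 -J1; apply: leq_trans cSJ _; rewrite leq_add2r.
  - by apply: le_trans hS; apply: ler_wpM2l.
  - by apply: le_trans gn; rewrite -natr1 mulrDr mulr1 lerD2r.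
have BB : [set Q in B | ~~ (J \subset Q)] \subset B.
  by apply/subsetP => Q; rewrite inE => /andP[].
have LB' : L \in [set Q in B | ~~ (J \subset Q)] by rewrite inE LB JL.
have dB' : down_closed [set Q in B | ~~ (J \subset Q)].
  move=> Q Q'; rewrite !inE => /andP[Q'B JQ'] QQ'; rewrite (dB _ _ Q'B QQ') /=.
  by apply: contra JQ' => JQ; exact: subset_trans QQ'.
split => //; first exact: subset_trans BB BB0.
exists a, b; split => //.
  by apply: le_trans hS; apply: ler_wpM2l; [rewrite exprn_ge0|exact: hit_mono].
by apply: le_trans pS _; apply: potential_mono => //; exact: dB' LB' SL.
Qed.

Lemma invariant0 L : L \in B0 -> run_inv L (set0, B0).
Proof.
move=> LB; split => //=; first exact: sub0set.
exists 0%N, 0%N; split; first by rewrite cards0.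
  by rewrite expr0 mul1r hit_le1.
by rewrite mulr0; apply: potential_ge0 => //; exact: B0_down LB (sub0set L).
Qed.

Lemma run_invariant L : L \in B0 -> run_inv L (run L).
Proof.
move=> LB; rewrite /run; elim: (size_of _) => [|k IH]; first exact: invariant0.
exact: invariant_answer.
Qed.

Lemma run_stuck L J : L \in B0 -> ~~ splits (run L).1 (run L).2 J.
Proof.
move=> LB.
have : pick_query (run L) = None.
  apply: (@iter_answer_stops T pick_query (run_inv L)); first exact: invariant0.
    exact: invariant_answer.
  move=> st J' [dB SL LB' _ _]; rewrite /pick_query; case: pickP => // J1 /and4P[d n0 SJ _] [<-].
  rewrite SJ andbT; apply: contraNN n0 => /setIidPl JS.
  by move: d; rewrite -setI_eq0 JS.
by rewrite /pick_query; case: pickP => // /(_ J) ->.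
Qed.

(** The whole outcome is thus a function of the set [S] it records. *)
Lemma run_fingerprint L : L \in B0 -> run (run L).1 = run L.
Proof. by move=> LB; apply: iter_answer_eq => //; have [] := run_invariant LB. Qed.

End Containers.

(** * Monotonicity of the Janson property and numerical estimates *)

Section Assembly.
Variables (R : realType) (T : finType).
Implicit Types (L S X Y : {set T}) (B H : {set {set T}}) (p q r : R).

(** A witness extends by zero; hence the bad sets form a down-closed family. *)
Lemma janson_mono H L L' p r : L' \subset L ->
  janson L' (induced H L') p r -> janson L (induced H L) p r.
Proof.
move=> LL' [nu [nu0 lt]]; pose nu' (E : {set T}) := if E \subset L' then nu E else 0.
have indE (E : {set T}) : (E \in induced H L') = (E \in induced H L) && (E \subset L').
  rewrite !inE; case EL': (E \subset L'); last by rewrite !andbF.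
  by rewrite (subset_trans EL' LL') !andbT.
have eE : e_nu (induced H L) nu' = e_nu (induced H L') nu.
  by rewrite /e_nu [RHS](eq_bigl _ _ indE) [RHS]big_mkcondr.
have dE K : d_nu (induced H L) nu' K = d_nu (induced H L') nu K.
  rewrite /d_nu [RHS](eq_bigl (fun E : {set T} => (E \in induced H L) && (K \subset E) && (E \subset L'))).
    by rewrite [RHS]big_mkcondr.
  by move=> E; rewrite indE andbAC.
exists nu'; split=> [E EL|].
  by rewrite /nu'; case: ifP => // EL'; apply: nu0; rewrite indE EL EL'.
rewrite eE; apply: le_lt_trans lt; rewrite /Lambda big_mkcond [leRHS]big_mkcond.
apply: ler_sum => K _; rewrite dE.
case KL': (K \subset L'); first by rewrite (subset_trans KL' LL').
rewrite /= /d_nu big1 ?expr0n ?mul0r; first by case: ifP.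
move=> E /andP[]; rewrite inE => /andP[_ EL'] KE.
by rewrite (subset_trans KE EL') in KL'.
Qed.

Lemma card_small_sets (t m : R) : 0 < t -> t <= 1 ->
  #|[set S : {set T} | #|S|%:R <= m]|%:R <= t^-1 `^ m * (1 + t) ^+ #|T|.
Proof.
move=> t0 t1; have := sum_subset_pow t [set: T]; rewrite cardsT => <-.
rewrite -sum1_card natr_sum big_distrr /= big_mkcond [leRHS]big_mkcond /=.
apply: ler_sum => S _; rewrite inE subsetT.
have pos : 0 <= t^-1 `^ m * t ^+ #|S| by rewrite mulr_ge0 ?powR_ge0 // exprn_ge0 // ltW.
case: ifP => // Sm; rewrite -(ler_pM2r (x := t ^- #|S|)) ?invr_gt0 ?exprn_gt0 //.
rewrite mulfK ?expf_neq0 ?gt_eqF // mul1r -exprVn -powR_mulrn; last by rewrite invr_ge0 ltW.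
by apply: ler_powR => //; rewrite invf_ge1.
Qed.

Lemma exp_bound (x : R) n : 0 <= x -> (1 + x) ^+ n <= 16 `^ (x * n%:R).
Proof.
move=> x0; rewrite powRrM powR_mulrn ?powR_ge0 //.
apply: lerXn2r; rewrite ?nnegrE ?addr_ge0 ?powR_ge0 //.
rewrite /powR gt_eqF //; apply: le_trans (expR_ge1Dx x) _; rewrite ler_expR ler_peMr //.
have -> : (16 : R) = (2 ^+ 4) by ring.
rewrite lnXn //.
(* This gives [ln 2 >= 1/2], hence [ln 16 >= 2]. *)
have : ln (1 + - 2^-1) <= - 2^-1 :> R by apply: le_ln1Dx; lra.
have -> : 1 + - 2^-1 = 2^-1 :> R by field.
by rewrite lnV ?posrE // lerN2 => h; rewrite -[ln 2 *+ 4]mulr_natr; lra.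
Qed.

(** Taking logarithms, [ln 2 >= 1/2] and [- ln (1 - q) <= q / (1 - q) <= 16/15 * q] give
    [a <= 32/15 * q * n]. *)
Lemma hit_exponent_le q (n a : nat) : 0 < q -> q <= 1 / 16 ->
  2 ^+ a * (1 - q) ^+ n <= 1 -> a%:R <= 3 * q * n%:R.
Proof.
move=> q0 q16 h.
have q1 : 0 < 1 - q by lra.
have : ln (2 ^+ a * (1 - q) ^+ n) <= 0 :> R by rewrite ln_le0.
rewrite lnM ?posrE ?exprn_gt0 // !lnXn //.
have l2 : 2^-1 <= ln 2 :> R.
  have : ln (1 + - 2^-1) <= - 2^-1 :> R by apply: le_ln1Dx; lra.
  have -> : 1 + - 2^-1 = 2^-1 :> R by field.
  by rewrite lnV ?posrE // lerN2.
have lq : - (16 / 15 * q) <= ln (1 - q).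
  have iq : (1 - q)^-1 = 1 + q / (1 - q) by field; rewrite gt_eqF.
  have : ln (1 - q)^-1 <= q / (1 - q).
    by rewrite [X in ln X]iq; apply: le_ln1Dx; apply: (@lt_le_trans _ _ 0); [rewrite ltrN10|rewrite divr_ge0 ?ltW].
  rewrite lnV ?posrE // lerNl => le1; apply: le_trans le1; rewrite lerN2 ler_pdivrMr //.
  nra.
rewrite -[ln 2 *+ a]mulr_natr -[ln (1 - q) *+ n]mulr_natr => le0.
have a0 : 0 <= a%:R :> R by [].
have n0 : 0 <= n%:R :> R by [].
have h1 := ler_wpM2r a0 l2.
have h2 := ler_wpM2r n0 lq.
nra.
Qed.

Definition container (st : {set T} * {set {set T}}) : {set T} :=
  st.1 :|: [set v | v |: st.1 \in st.2].

End Assembly.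

(** * No container is Janson, and the final count *)

Section Final.
Variables (R : realType) (T : finType).
Implicit Types (L S X Y : {set T}) (B H : {set {set T}}) (p q r : R).

(** A witness would have mass [e] with [W < e ^+ 2]. The second moment bound gives [u <= 0.51 * e]
    and the potential gives [b <= 0.46 * e], contradicting [e = u + b]. *)
Lemma stuck_not_janson (s : nat) p q (Rr : R) H B S :
  0 < p -> 0 < q -> q <= 1 / 16 -> 0 < Rr -> (0 < s)%N ->
  p <= q / (2 ^+ 10 * s%:R ^+ 2) -> 2 ^- 6 * p * #|T|%:R <= Rr ->
  uniform s H -> down_closed B -> S \in B ->
  (forall Q, Q \in B -> ~ janson Q (induced H Q) (p / q) (2 ^- (2 * s + 2) * Rr)) ->
  (forall J, ~~ splits p q (2 ^+ 10) (p / (5 * q * 2 ^+ 10)) S B J) ->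
  ~ janson (container (S, B)) (induced H (container (S, B))) p Rr.
Proof.
move=> p0 q0 q16 R0 s0 ps Rn uH dB SB bad stuck [nu [nu0 lt]].
set X := container (S, B) in nu0 lt; set G := induced H X in nu0 lt.
have q1 : q <= 1 by lra.
have sR0 : 0 < s%:R :> R by rewrite ltr0n.
have s1 : 1 <= s%:R :> R by rewrite ler1n.
have pq : p / q * s%:R ^+ 2 <= 1 / 1024.
  move: ps; rewrite ler_pdivlMr ?mulr_gt0 ?exprn_gt0 // => ps.
  have -> : p / q * s%:R ^+ 2 = p * (2 ^+ 10 * s%:R ^+ 2) / q / 1024.
    by field; rewrite gt_eqF.
  by apply: ler_wpM2r; [lra|rewrite ler_pdivrMr ?mul1r].
have pq0 : 0 < p / q by rewrite divr_gt0.
pose e := e_nu G nu; pose W := Rr * Lambda X G nu p.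
have We : W < e ^+ 2 by move: lt; rewrite ltr_pdivlMr // mulrC.
pose u := \sum_(E in G | S :|: E \in B) nu E.
pose b := \sum_(E in G | S :|: E \notin B) nu E.
have eub : e = u + b by rewrite /e /e_nu (bigID (fun E => S :|: E \in B)).
have u0 : 0 <= u by apply: sumr_ge0 => E /andP[EG _]; exact: nu0.
have b0 : 0 <= b by apply: sumr_ge0 => E /andP[EG _]; exact: nu0.
have L0 : 0 <= Lambda X G nu p.
  by apply: sumr_ge0 => K _; rewrite mulr_ge0 ?sqr_ge0 // invr_ge0 exprn_ge0 // ltW.
have W0 : 0 <= W by rewrite mulr_ge0 // ltW.
(* Bernoulli's inequality gives [(1 - p/q) ^+ s >= 1023/1024], and [(1 + x) * (1 - x) <= 1]. *)
have growth : (1 + p / q) ^+ s <= 1024 / 1023.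
  have bern_ineq (y : R) m : 0 <= y <= 1 -> 1 - m%:R * y <= (1 - y) ^+ m.
    move=> /andP[y0 y1]; elim: m => [|m IH]; first by rewrite mul0r subr0 expr0.
    rewrite exprS -natr1.
    have m0 : 0 <= m%:R :> R by [].
    by apply: le_trans (ler_wpM2l _ IH); nra.
  have pq1 : p / q <= 1 by nra.
  have := bern_ineq (p / q) s; rewrite (ltW pq0) pq1 => /(_ isT) h.
  have h1 : 1023 / 1024 <= (1 - p / q) ^+ s by nra.
  have : (1 + p / q) ^+ s * (1 - p / q) ^+ s <= 1.
    by rewrite -exprMn; apply: exprn_ile1; nra.
  have : 0 <= (1 + p / q) ^+ s by rewrite exprn_ge0 // addr_ge0 // ltW.
  by nra.
have hitS : 0 < hit q B S.
  by apply: lt_le_trans (hit_ge _ _ SB); [rewrite exprn_gt0 //; lra|exact: ltW|].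
have uW : u ^+ 2 <= 1 / 4 * (1024 / 1023) * W.
  have r0 : 0 < 2 ^- (2 * s + 2) * Rr by rewrite mulr_gt0 // invr_gt0 exprn_gt0.
  have := @unblocked_mass R T s p q _ H B S X nu p0 q0 q1 r0 uH dB bad.
  rewrite -/G -/u => /(_ _ hitS nu0) h.
  apply: (le_trans (h _)).
    (* As [E :\: S] is not a splitting query, adding [E] costs at most a factor
       [2 ^+ #|E :\: S| <= 2 ^+ s]; when [E] lies inside [S] nothing changes. *)
    move=> E EH EB; have := stuck (E :\: S).
    have SES : S :|: (E :\: S) = S :|: E by apply/setP => x; rewrite !inE; case: (x \in S).
    have dis : [disjoint E :\: S & S] by rewrite disjoints_subset setDE subsetIr.
    rewrite /splits dis SES EB /=.
    have [|ne] := boolP (E :\: S == set0).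
      rewrite setD_eq0 => /setUidPl -> _.
      by rewrite ler_peMl ?(ltW hitS) // exprn_ege1 // ler1n.
    rewrite negb_or -leNgt => /andP[le _]; apply: (le_trans le).
    apply: ler_wpM2r.
      by apply: sumr_ge0 => Q _; rewrite mulr_ge0 // bern_ge0 // ltW.
    rewrite ler_weXn2l ?ler1n // -(uH _ EH); exact/subset_leq_card/subsetDl.
  have -> : 4 ^+ s * (2 ^- (2 * s + 2) * Rr) * (1 + p / q) ^+ s * Lambda X G nu p =
     1 / 4 * (1 + p / q) ^+ s * W.
    rewrite exprD exprM (_ : 2 ^+ 2 = 4 :> R); last by ring.
    by rewrite /W; field; rewrite expf_neq0 ?pnatr_eq0.
  by apply: ler_wpM2r => //; apply: ler_wpM2l => //; lra.
have bW : ((1 - 45 / 100) * b) ^+ 2 <= 1 / 16 * W.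
  have alpha1 : 1 <= (2 ^+ 10 : R) by rewrite exprn_ege1 // ler1n.
  have GX E : E \in G -> E \subset X by rewrite inE => /andP[].
  have th : 45 / 100 <= 1 :> R by lra.
  apply: le_trans (blocked_mass p0 alpha1 SB th GX nu0 _) _; last first.
    rewrite /W mulrA; apply: ler_wpM2r => //.
    have -> : p / 2 ^+ 10 * #|T|%:R = 1 / 16 * (2 ^- 6 * p * #|T|%:R) by field.
    by apply: ler_wpM2l => //; lra.
  move=> E EG EB.
  have EH : E \in H by move: EG; rewrite inE => /andP[].
  have ES : (#|E :\: S| <= s)%N by rewrite -(uH _ EH); exact/subset_leq_card/subsetDl.
  (* The allowance [theta = 45/100] is shared equally among at most [s] vertices. *)
  apply: (@le_trans _ _ (\sum_(v in E :\: S) (45 / 100) / s%:R)); last first.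
    rewrite sumr_const -[_ *+ _]mulr_natr mulrAC ler_pdivrMr //.
    by apply: ler_wpM2l; [lra|rewrite ler_nat].
  apply: ler_sum => v; rewrite inE => /andP[vS vE].
  have vX : v |: S \in B.
    by have := subsetP (GX _ EG) v vE; rewrite !inE (negPf vS).
  (* As [v] is in the container, adding it stays in [B]; not splitting then means that the gain from
     [potential_gain] is below [gamma]. *)
  have := stuck [set v].
  rewrite /splits disjoints_subset sub1set inE vS setUC vX cards1 eqxx /=.
  rewrite -card_gt0 cards1 /= negb_or => /andP[_]; rewrite -ltNge => gn.
  have := le_lt_trans (potential_gain p0 alpha1 dB SB vX vS) gn.
  rewrite ltrD2l.
  have y0 : 0 <= deg (opt p (2 ^+ 10) S B) [set v] / p.
    rewrite divr_ge0 ?(ltW p0) //; have [ad _] := optP p0 alpha1 SB; exact: deg_ge0 ad.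
  rewrite (_ : 2 ^+ 10 / p * _ = 2 ^+ 10 * (deg (opt p (2 ^+ 10) S B) [set v] / p)); last first.
    by rewrite mulrAC mulrA.
  move: (deg _ _ / p) y0 => y y0 ysq.
  rewrite ler_pdivlMr //.
  have k : (p / (5 * q * 2 ^+ 10)) * (s%:R ^+ 2 * 2 ^+ 20) <= 1 / 5.
    have -> : (p / (5 * q * 2 ^+ 10)) * (s%:R ^+ 2 * 2 ^+ 20) = (p / q * s%:R ^+ 2) * (1024 / 5).
      by field; rewrite gt_eqF.
    lra.
  (* The square root of [1/5] is below [45/100]. *)
  have z : (2 ^+ 10 * y * s%:R) ^+ 2 <= 1 / 5.
    have -> : (2 ^+ 10 * y * s%:R) ^+ 2 = y ^+ 2 * (s%:R ^+ 2 * 2 ^+ 20) by ring.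
    apply: le_trans k; apply: ler_wpM2r; last exact: ltW.
    by rewrite mulr_ge0 ?exprn_ge0 // ltW.
  have z0 : 0 <= 2 ^+ 10 * y * s%:R by rewrite mulr_ge0 ?(ltW sR0) // mulr_ge0 // exprn_ge0.
  by move: (2 ^+ 10 * y * s%:R) z z0 => x; nra.
clear -We eub u0 b0 W0 uW bW.
have e0 : 0 < e by nra.
have ue : u <= 51 / 100 * e by nra.
have be : b <= 46 / 100 * e by nra.
lra.
Qed.

End Final.

Theorem theorem4p1 (R : realType) (s n : nat) (p q Rr eta : R) :
  (s <= n)%N -> 0 < p -> 0 < q -> 0 < Rr -> 0 < eta ->
  q <= 1 / 16 ->
  p <= q / (2 ^+ 10 * (s%:R) ^+ 2) ->
  Rr >= 2 ^- 6 * p * n%:R ->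
  eta = 2 ^- (2 * s + 2) ->
  forall H : {set {set 'I_n}}, uniform s H ->
  exists X : {set {set 'I_n}},
    (#|X|%:R <= 4 * (2 / q) `^ (8 * q * n%:R)) /\
    (forall L : {set 'I_n}, ~ janson L (induced H L) (p / q) (eta * Rr) ->
       exists2 Y, Y \in X & L \subset Y) /\
    (forall Y, Y \in X -> ~ janson Y (induced H Y) p Rr).
Proof.
move=> sn p0 q0 R0 _ q16 ps Rn etaE H uH.
(* For [s = 0] the bound on [p] would read [p <= 0], since the inverse of zero is zero. *)
have s0 : (0 < s)%N.
  rewrite lt0n; apply/eqP => s0; move: ps; rewrite s0 expr0n mulr0 invr0 mulr0.
  by rewrite leNgt p0.
have q1 : q <= 1 by lra.
have qge0 := ltW q0.
pose alpha : R := 2 ^+ 10.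
(* Chosen so that [gamma * b <= p / alpha * n] says exactly [b <= 5 * q * n]. *)
pose gamma : R := p / (5 * q * alpha).
have alpha1 : 1 <= alpha by rewrite exprn_ege1 // ler1n.
have alpha0 : 0 < alpha by rewrite exprn_gt0.
have gamma0 : 0 < gamma by rewrite divr_gt0 // !mulr_gt0.
pose B0 : {set {set 'I_n}} := [set L | `[< ~ janson L (induced H L) (p / q) (eta * Rr) >]].
have B0P L : L \in B0 -> ~ janson L (induced H L) (p / q) (eta * Rr).
  by rewrite inE => /asboolP.
have dB0 : down_closed B0.
  move=> L L' /B0P nj LL'; rewrite inE; apply/asboolP; apply: contra_not nj.
  exact: janson_mono.
pose rn := run p q alpha gamma B0.
have inv L : L \in B0 -> run_inv p q alpha gamma B0 L (rn L) by exact: run_invariant.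
exists [set container (rn L) | L in B0]; split; [|split].
- pose small := [set S : {set 'I_n} | #|S|%:R <= 8 * q * n%:R].
  (* By [run_fingerprint] every container also arises from the run on its recorded set, whose size
     is at most [a + b <= 3 * q * n + 5 * q * n]. *)
  have sub : [set container (rn L) | L in B0] \subset [set container (rn S) | S in small].
    apply/subsetP => Y /imsetP[L LB ->]; apply/imsetP; exists (rn L).1; last first.
      by rewrite /rn run_fingerprint.
    have [dB SL LB' BB0 [a [b [cS ha hb]]]] := inv L LB.
    have SB : (rn L).1 \in (rn L).2 by exact: dB LB' SL.
    have le_b : b%:R <= 5 * q * n%:R :> R.
      have := le_trans hb (potential_le p0 alpha1 SB); rewrite card_ord /gamma.
      have -> : p / (5 * q * alpha) * b%:R = p / alpha * (b%:R / (5 * q)).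
        by field; rewrite !gt_eqF.
      by rewrite ler_pM2l ?divr_gt0 // ler_pdivrMr ?mulr_gt0 // mulrC.
    have le_a : a%:R <= 3 * q * n%:R :> R.
      apply: hit_exponent_le => //; apply: le_trans ha; apply: ler_wpM2l.
        by rewrite exprn_ge0.
      by have := hit_ge qge0 q1 SB; rewrite card_ord.
    rewrite inE; apply: (@le_trans _ _ (a + b)%:R); first by rewrite ler_nat.
    by rewrite natrD; lra.
  have cardle : (#|[set container (rn L) | L in B0]| <= #|small|)%N.
    exact: leq_trans (subset_leq_card sub) (leq_imset_card _ _).
  apply: (@le_trans _ _ (#|small|%:R)); first by rewrite ler_nat.
  have t0 : 0 < 8 * q by rewrite mulr_gt0.
  have t1 : 8 * q <= 1 by lra.
  apply: le_trans (card_small_sets _ _ t0 t1) _; rewrite card_ord.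
  apply: (@le_trans _ _ ((2 / q) `^ (8 * q * n%:R))); last first.
    by rewrite ler_peMl ?powR_ge0 // ler1n.
  (* With [t = 8 * q], the first factor is the base in [card_small_sets], and [16] is the base in
     [exp_bound], which absorbs [(1 + t) ^+ n]. *)
  have -> : 2 / q = (8 * q)^-1 * 16 by field; rewrite gt_eqF.
  rewrite powRM ?invr_ge0 ?(ltW t0) //; apply: ler_wpM2l; first exact: powR_ge0.
  exact: exp_bound (ltW t0).
- move=> L nj; have LB : L \in B0 by rewrite inE; apply/asboolP.
  exists (container (rn L)); first exact: imset_f.
  have [dB SL LB' BB0 _] := inv L LB.
  apply/subsetP => v vL; rewrite !inE; case vS: (v \in _) => //=.
  by apply: dB LB' _; rewrite subUset sub1set vL.
- move=> Y /imsetP[L LB ->]; have [dB SL LB' BB0 _] := inv L LB.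
  have SB : (rn L).1 \in (rn L).2 by exact: dB LB' SL.
  rewrite (surjective_pairing (rn L)).
  apply: (@stuck_not_janson R _ s p q) => //.
  + by rewrite card_ord.
  + by move=> Q QB; rewrite -etaE; apply: B0P; exact: subsetP BB0 _ QB.
  + by move=> J; apply: run_stuck.
Qed.
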